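(* Let $\Omega \subset \mathbb{R}^2$ be a compact convex set with nonempty interior, let $M > 0$, and let $f : \mathbb{R}^2 \to \mathbb{R}$ be a positive continuous function satisfying the following condition: for every $N > 0$ there exists $\delta > 0$ such that for all $x, y \in \mathbb{R}^2$ with $y \neq 0$ and $(1+|x|)/|y| < \delta$ one has $$\frac{(1+|x|)\,f(x)}{|y|\,f(y)} > N .$$ Let $u$ be a solution to the problem of minimizing $$F(u) = \int_\Omega f(\nabla u(x))\, dx$$ in the class of concave functions $u : \Omega \to \mathbb{R}$ satisfying $0 \le u(x) \le M$ for all $x \in \Omega$. Let $x_0 \in \partial\Omega$ be a regular point of $\partial\Omega$, let $l$ be the unique support line to $\Omega$ at $x_0$, and suppose that the endpoints of the segment $l \cap \partial\Omega$ are also regular points of $\partial\Omega$ (if this segment degenerates to the single point $x_0$, this last requirement adds nothing). Then $u(x_0) = 0$.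
   Context: $|\cdot|$ denotes the Euclidean norm on $\mathbb{R}^2$. A concave function $u$ on $\Omega$ is differentiable at almost every point of $\Omega$, so $\nabla u$ exists almost everywhere and the integral $F(u)$ is well defined. A solution to the minimization problem is a function $u$ in the stated class such that $F(u) \le F(v)$ for every $v$ in the class. No continuity of $u$ up to the boundary is assumed. A support line to $\Omega$ at $x_0 \in \partial\Omega$ is a line through $x_0$ such that $\Omega$ is contained in one of the two closed half-planes bounded by this line. A point $x_0 \in \partial\Omega$ is called regular if the support line to $\Omega$ at $x_0$ is unique. *)

(* Defs.v *)
From mathcomp Require Import all_boot all_order all_algebra.
From mathcomp Require Import interval_inference.
From mathcomp Require Import all_classical all_reals all_analysis.

Set Implicit Arguments.
Unset Strict Implicit.
Unset Printing Implicit Defensive.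

Import Order.TTheory GRing.Theory Num.Theory.
Import numFieldNormedType.Exports.

Local Open Scope classical_set_scope.
Local Open Scope ring_scope.
Local Open Scope convex_scope.

(* The plane is R * R.  The library norm `|x| on R * R is the maximum of the
   absolute values of the coordinates; it is used only through the topology
   (and notion of derivative) it induces, which is the Euclidean one. *)

Definition dot2 (R : realType) (x y : R * R) : R := x.1 * y.1 + x.2 * y.2.

Definition enorm (R : realType) (x : R * R) : R := Num.sqrt (dot2 x x).

Definition concave_function (R : realType) (E : lmodType R)
    (E' := convex_lmodType E) (D : set E') (f : E' -> R^o) : Prop :=
  forall t : {i01 R},
    {in D &, forall x y : E', f x <| t |> f y <= f (x <| t |> y)}.

Definition segment (R : realType) (a b : R * R) : set (R * R) :=
  [set (1 - t) *: a + t *: b | t in `[0, 1]%classic].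

Definition boundary (T : topologicalType) (A : set T) : set T :=
  closure A `\` A°.

(* The half-plane is given by <= only: the opposite one is obtained by
   replacing (n, c) with (- n, - c), which leaves the line unchanged. *)
Definition support_line (R : realType) (Omega : set (R * R)) (x0 : R * R)
    (l : set (R * R)) : Prop :=
  l x0 /\
  exists n : R * R, exists c : R,
    [/\ n != 0,
        l = [set x | dot2 n x = c] &
        Omega `<=` [set x | dot2 n x <= c]].

Definition regular_point (R : realType) (Omega : set (R * R)) (x0 : R * R) :
    Prop :=
  boundary Omega x0 /\ exists! l : set (R * R), support_line Omega x0 l.

(* Where a partial derivative of u does not exist, the corresponding component
   is an unspecified default value. *)
Definition grad (R : realType) (u : R * R -> R) (x : R * R) : R * R :=
  ('D_((1, 0) : R * R) u x, 'D_((0, 1) : R * R) u x).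

(* A function on Omega is represented by a total function u, of which only the
   restriction to Omega matters.  The values of u off Omega can only influence
   grad u on the boundary of Omega, which is Lebesgue-negligible when Omega is
   convex.  The integral of the nonnegative integrand is taken in \bar R. *)
Definition newton_functional (R : realType) (f : R * R -> R)
    (Omega : set (R * R)) (u : R * R -> R) : \bar R :=
  (\int[@lebesgue_measure R \x @lebesgue_measure R]_(x in Omega)
     (f (grad u x))%:E)%E.

Definition admissible (R : realType) (Omega : set (R * R)) (M : R)
    (u : R * R -> R) : Prop :=
  concave_function Omega u /\ (forall x, Omega x -> 0 <= u x <= M).

Definition is_solution (R : realType) (f : R * R -> R) (Omega : set (R * R))
    (M : R) (u : R * R -> R) : Prop :=
  admissible Omega M u /\
  forall v : R * R -> R, admissible Omega M v ->
    (newton_functional f Omega u <= newton_functional f Omega v)%E.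

Definition growth_condition (R : realType) (f : R * R -> R) : Prop :=
  forall N : R, 0 < N ->
    exists2 delta : R, 0 < delta &
      forall x y : R * R, y != 0 -> (1 + enorm x) / enorm y < delta ->
        N < ((1 + enorm x) * f x) / (enorm y * f y).

(* Main.v *)
Require Import Defs.
From mathcomp Require Import all_boot all_order all_algebra.
From mathcomp Require Import interval_inference.
From mathcomp Require Import all_classical all_reals all_analysis.
From mathcomp Require Import measurable_realfun ring lra.

(** Suppose u x0 > 0 and let d be the distance to a support line at x0, up to
    normalisation.  Let H be the limit, as r -> 0, of the supremum of u over
    the part of Omega where d < r; by compactness it is attained in the limit
    at a point x1 of the line.  For large k the competitor min (u, k d) differs
    from u only on the convex set W = {u >= k d}, on which u <= (1 + delta) H
    and d <= 2 H / k, and there its gradient is k times that of d.  If a is a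
    point of W almost farthest from x1 along the line, the points
    (1 - t) j + t a, with t of order delta and j in a cone with apex x1 at
    height of order H / k, fill a proportion of order delta of W.  By concavity
    u >= (1 - 2 delta) H on balls of radius of order H / k about them, so the
    gradient of u there is at most of order delta k, and the growth condition
    makes f (grad u) larger than f (k grad d) by an arbitrarily large multiple
    of 1 / delta.  Hence the competitor has a smaller functional than u. *)

Set Implicit Arguments.
Unset Strict Implicit.
Unset Printing Implicit Defensive.

Import Order.TTheory GRing.Theory Num.Theory.
Import numFieldNormedType.Exports.

Local Open Scope classical_set_scope.
Local Open Scope ring_scope.

(** * Lebesgue measure on the plane *)

Section plane_measure.
Context {R : realType}.
Implicit Types (t : R).
Local Notation leb := (@lebesgue_measure R).
Local Notation mu := (leb \x leb)%E.
Local Notation mset A := (measurable (A : set (measurableTypeR R * measurableTypeR R))).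

Lemma measurable_affine1 (a t : R) :
  measurable_fun setT ((fun x => a + t * x) : measurableTypeR R -> measurableTypeR R).
Proof.
apply: measurable_funD; first exact: measurable_cst.
exact: measurable_funM.
Qed.

(** Lebesgue measure is determined by its values on half-open intervals, so it suffices to compute
    the rescaled pushforward there. *)
Lemma lebesgue_affine1 (a t : R) (A : set R) : 0 < t -> measurable A ->
  (t%:E * leb [set x | A (a + t * x)%R] = leb A)%E.
Proof.
move=> t0 mA.
pose g : measurableTypeR R -> measurableTypeR R := fun x => a + t * x.
have mg : measurable_fun setT g by exact: measurable_affine1.
pose m' : {measure set (measurableTypeR R) -> \bar R} :=
  mscale (NngNum (ltW t0)) (pushforward leb g).
suff E X : ocitv X -> leb X = m' mg X by rewrite (lebesgue_measure_unique E mA).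
case=> -[c d] _ <-.
rewrite /m'/= /mscale /pushforward.
rewrite [X in (_ * leb X)%E](_ : _ = `](c - a) / t, (d - a) / t]%classic).
  rewrite !lebesgue_measure_itv/= !lte_fin.
  rewrite ltr_pM2r ?invr_gt0// ltrD2r; case: ifPn; rewrite ?mule0// => _.
  by rewrite !EFinN -!EFinB -EFinM; congr EFin; field; rewrite gt_eqF.
apply/seteqP; split => x; rewrite /= /g !in_itv/= ltr_pdivrMr// ler_pdivlMr// mulrC.
  by move=> /andP[? ?]; apply/andP; split; lra.
by move=> /andP[? ?]; apply/andP; split; lra.
Qed.

(** Uniqueness of the product measure reduces the claim to rectangles, where each coordinate
    contributes one factor [t]. *)
Lemma plane_measure_affine (a : R * R) t (A : set (R * R)) : 0 < t -> mset A ->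
  ((t * t)%:E * mu [set x | A (a + t *: x)%R] = mu A)%E.
Proof.
move=> t0 mA.
pose g1 (b : R) : measurableTypeR R -> measurableTypeR R := fun x => b + t * x.
pose g : measurableTypeR R * measurableTypeR R ->
    measurableTypeR R * measurableTypeR R := fun x => (g1 a.1 x.1, g1 a.2 x.2).
have mg : measurable_fun setT g.
  by apply: measurable_fun_pair; apply: (measurableT_comp (measurable_affine1 _ _)).
have t20 : 0 <= t * t by rewrite mulr_ge0// ltW.
pose m' : {measure set (measurableTypeR R * measurableTypeR R) -> \bar R} :=
  mscale (NngNum t20) (pushforward mu g).
suff E (X Y : set (measurableTypeR R)) : measurable X -> measurable Y ->
    m' mg (X `*` Y) = (leb X * leb Y)%E.
  by rewrite (product_measure_unique E mA).
move=> mX mY; rewrite /m'/= /mscale /pushforward.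
rewrite -[LHS]/((t * t)%:E * mu ([set x | X (a.1 + t * x)%R] `*` [set x | Y (a.2 + t * x)%R]))%E.
rewrite product_measure1E//; first last.
- by rewrite -[X in measurable X]setTI; exact: measurable_affine1.
- by rewrite -[X in measurable X]setTI; exact: measurable_affine1.
rewrite -(lebesgue_affine1 a.1 t0 mX) -(lebesgue_affine1 a.2 t0 mY).
by rewrite muleACA -EFinM.
Qed.

Lemma plane_measure_translate (a : R * R) (A : set (R * R)) : mset A ->
  mu [set x | A (a + x)] = mu A.
Proof.
move=> mA; rewrite -[RHS](plane_measure_affine a ltr01 mA) mulr1 mul1e.
by under [in RHS]eq_fun do rewrite scale1r.
Qed.

Lemma box_measurable (a b c d : R) : mset (`]a, b[%classic `*` `]c, d[%classic).
Proof. by apply: measurableX; exact: measurable_itv. Qed.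

(** Measurability refers to the product sigma-algebra, so the open set is exhibited as a countable
    union of boxes with rational centre and half-width. *)
Lemma plane_open_measurable (O : set (R * R)) : open O -> mset O.
Proof.
move=> oO.
pose box (i : rat * rat * rat) : set (R * R) :=
  `](ratr i.1.1 - ratr i.2), (ratr i.1.1 + ratr i.2)[%classic `*`
  `](ratr i.1.2 - ratr i.2), (ratr i.1.2 + ratr i.2)[%classic.
pose F i : set (R * R) := [set x | box i `<=` O /\ box i x].
rewrite (_ : O = \bigcup_i F i).
  apply: countable_bigcupT_measurable => // i.
  have [bO|bO] := pselect (box i `<=` O).
    rewrite (_ : F i = box i); first exact: box_measurable.
    by apply/seteqP; split => x // -[].
  by rewrite (_ : F i = set0)//; apply/seteqP; split => x // -[].
apply/seteqP; split => [[x y] Oxy|x [i _ [bO /bO]]//].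
have /nbhs_ballP[e /= e0 eO] : nbhs (x, y) O by exact: open_nbhs_nbhs.
(* Less than [e / 2], since the centre of the box is itself displaced from the point by up to
   [r]. *)
have [r] : exists q : rat, ratr q \in `]0, (e / 2)[.
  by apply: rat_in_itvoo; rewrite divr_gt0.
rewrite in_itv/= => /andP[r0 re].
have [p] : exists q : rat, ratr q \in `](x - ratr r), (x + ratr r)[.
  by apply: rat_in_itvoo; lra.
rewrite in_itv/= => /andP[p1 p2].
have [q] : exists q : rat, ratr q \in `](y - ratr r), (y + ratr r)[.
  by apply: rat_in_itvoo; lra.
rewrite in_itv/= => /andP[q1 q2].
exists (p, q, r) => //; split; last first.
  by split => /=; rewrite in_itv/=; apply/andP; split; lra.
move=> [z w] [/=]; rewrite !in_itv/= => /andP[? ?] /andP[? ?]; apply: eO.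
by split; rewrite /ball/= ltr_norml; apply/andP; split; lra.
Qed.

Lemma plane_closed_measurable (C : set (R * R)) : closed C -> mset C.
Proof.
move=> cC; rewrite -(setCK C); apply: measurableC.
by apply: plane_open_measurable; exact: closed_openC.
Qed.

Lemma box_measure (a b r : R) : 0 <= r ->
  mu (`](a - r), (a + r)[%classic `*` `](b - r), (b + r)[%classic) =
  ((r + r) * (r + r))%:E.
Proof.
move=> r0; rewrite product_measure1E//; try exact: measurable_itv.
have E c : leb `](c - r), (c + r)[%classic = (r + r)%:E.
  rewrite lebesgue_measure_itv/= lte_fin; case: ifPn => [_|].
    by rewrite EFinN -EFinB; congr EFin; lra.
  by rewrite -leNgt => h; congr EFin; lra.
by rewrite EFinM; congr (_ * _)%E; exact: E.
Qed.

Lemma plane_bounded_measure (A : set (R * R)) (M : R) : mset A ->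
  (forall x, A x -> `|x| < M) -> (mu A < +oo)%E.
Proof.
move=> mA AM; have [M0|M0] := leP 0 M; last first.
  rewrite (_ : A = set0) ?measure0// -subset0 => x /AM.
  by have := normr_ge0 x; lra.
apply: (@le_lt_trans _ _ (mu (`](0 - M), (0 + M)[%classic `*` `](0 - M), (0 + M)[%classic))).
  apply: le_measure; rewrite ?inE//; first exact: box_measurable.
  move=> x /AM; rewrite prod_normE gt_max => /andP[].
  by rewrite !ltr_norml => /andP[? ?] /andP[? ?]; split => /=; rewrite in_itv/=; apply/andP; split; lra.
by rewrite box_measure// ltry.
Qed.

Lemma plane_open_measure_gt0 (O : set (R * R)) : open O -> O !=set0 -> (0 < mu O)%E.
Proof.
move=> oO [[x y] Oxy].
have /nbhs_ballP[e /= e0 eO] : nbhs (x, y) O by exact: open_nbhs_nbhs.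
apply: (@lt_le_trans _ _ (mu (`](x - e), (x + e)[%classic `*` `](y - e), (y + e)[%classic))).
  by rewrite box_measure ?ltW// lte_fin mulr_gt0 ?addr_gt0.
apply: le_measure; rewrite ?inE//; first exact: box_measurable.
  exact: plane_open_measurable.
move=> [z w] [/=]; rewrite !in_itv/= => /andP[? ?] /andP[? ?]; apply: eO.
by split; rewrite /ball/= ltr_norml; apply/andP; split; lra.
Qed.

End plane_measure.

(** * Integrals of functions that need not be measurable *)

Section lower_integral.
Context d (T : measurableType d) (R : realType).
Context (mu : {measure set T -> \bar R}).
Implicit Types (g h : T -> R) (A B D P : set T).
Import HBNNSimple.
Local Open Scope ereal_scope.

Lemma le_sintegral_integral D g (k : {nnsfun T >-> R}) :
  (forall x, D x -> (0 <= g x)%R) ->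
  (forall x, (k x)%:E <= ((EFin \o g) \_ D) x) ->
  sintegral mu k <= \int[mu]_(x in D) (g x)%:E.
Proof.
move=> g0 kg; rewrite ge0_integralE//.
by apply: ereal_sup_ubound; exists k.
Qed.

Lemma integral_le_sintegral D g (M : \bar R) :
  (forall x, D x -> (0 <= g x)%R) ->
  (forall k : {nnsfun T >-> R}, (forall x, (k x)%:E <= ((EFin \o g) \_ D) x) ->
    sintegral mu k <= M) ->
  \int[mu]_(x in D) (g x)%:E <= M.
Proof.
move=> g0 kM; rewrite ge0_integralE//.
by apply: ge_ereal_sup => _ [k /= kg <-]; apply: kM.
Qed.

(* [g] need not be measurable here or below: its integral is a supremum over
   simple functions, and those can be split along measurable sets. *)
Lemma integral_ge_cst_add D P B g (c : R) :
  measurable P -> measurable B -> mu P < +oo ->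
  P `<=` D -> B `<=` D -> P `&` B = set0 -> (0 <= c)%R ->
  (forall x, D x -> (0 <= g x)%R) -> (forall x, P x -> (c <= g x)%R) ->
  c%:E * mu P + \int[mu]_(x in B) (g x)%:E <= \int[mu]_(x in D) (g x)%:E.
Proof.
move=> mP mB Poo PD BD PB c0 g0 cg.
have Pfin : mu P \is a fin_num by rewrite ge0_fin_numE.
rewrite -leeBrDl ?fin_numM//.
apply: integral_le_sintegral => [x Bx|k kg]; first exact/g0/BD.
rewrite leeBrDl ?fin_numM//.
pose hP := scale_nnsfun (indic_nnsfun R mP) c0.
have <- : sintegral mu hP = c%:E * mu P.
  rewrite -[in RHS](sintegral_indic mu P).
  exact: (sintegralrM mu c (indic_nnsfun R mP)).
rewrite -sintegralD//.
apply: (@le_sintegral_integral D g (add_nnsfun hP k)) => // x.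
move: (kg x); rewrite /= !patchE !mindicE.
have [xP|xP] := boolP (x \in P).
  have -> : (x \in B) = false.
    by apply/negP => xB; move/seteqP: PB => [/(_ x) + _]; rewrite !inE in xP xB; exact.
  have -> : x \in D by rewrite inE; apply/PD; rewrite inE in xP.
  rewrite mulr1 /= !lee_fin => k0.
  have := cg x; rewrite inE in xP => /(_ xP); lra.
rewrite mulr0 add0r; case: ifPn => [xB|_ k0].
  by have -> : x \in D by rewrite inE; apply/BD; rewrite inE in xB.
by apply: (le_trans k0); case: ifPn => //; rewrite inE => /g0; rewrite /= lee_fin.
Qed.

(** A simple function below [h] is measurable, so its integral splits over [A], [B] and the null
    remainder; on [B] it also lies below [g]. This bounds the functional of the competitor. *)
Lemma integral_le_cst_add D A B g h (c : R) :
  measurable D -> measurable A -> measurable B ->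
  A `<=` D -> B `<=` D -> A `&` B = set0 -> mu (D `\` (A `|` B)) = 0 ->
  (0 <= c)%R -> (forall x, D x -> (0 <= h x)%R) -> (forall x, B x -> (0 <= g x)%R) ->
  (forall x, A x -> (h x <= c)%R) -> (forall x, B x -> (h x <= g x)%R) ->
  \int[mu]_(x in D) (h x)%:E <= c%:E * mu A + \int[mu]_(x in B) (g x)%:E.
Proof.
move=> mD mA mB AD BD AB N0 c0 h0 g0 hc hg.
apply: integral_le_sintegral => // k kh.
have kh' x : D x -> (k x <= h x)%R.
  by move=> Dx; move: (kh x); rewrite patchE mem_set//= lee_fin.
have k0 x : ~ D x -> k x = 0%R.
  move=> Dx; apply/eqP; rewrite eq_le fun_ge0 andbT.
  by move: (kh x); rewrite patchE memNset// lee_fin.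
pose N := D `\` (A `|` B).
have mN : measurable N by apply: measurableD => //; exact: measurableU.
have mk E : measurable_fun E (EFin \o k).
  by apply/measurable_EFinP; exact: measurable_funTS.
rewrite -integralT_nnsfun.
have -> : \int[mu]_x (k x)%:E = \int[mu]_(x in (A `|` B) `|` N) (k x)%:E.
  rewrite [RHS]integral_mkcond; apply: eq_integral => x _; rewrite patchE.
  case: ifPn => //; rewrite notin_setE => xE; congr EFin; apply: k0 => Dx.
  by apply: xE; have [?|?] := pselect ((A `|` B) x); [left|right].
rewrite ge0_integral_setU//=; [|exact: measurableU| |]; last 2 first.
- by move=> x _; rewrite lee_fin fun_ge0.
- by apply/disj_setPS => x [ABx [_ /(_ ABx)]].
rewrite [X in _ + X](_ : _ = 0) ?adde0; last exact: null_set_integral.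
rewrite ge0_integral_setU//=; last 2 first.
- by move=> x _; rewrite lee_fin fun_ge0.
- by apply/disj_setPS; rewrite AB.
apply: leeD.
  rewrite -(integral_cst _ mA); apply: ge0_le_integral => //.
  - by move=> x _; rewrite lee_fin fun_ge0.
  - by move=> x Ax; rewrite lee_fin; apply: (le_trans (kh' _ (AD _ Ax))); exact: hc.
rewrite integral_nnsfun// mrestrict.
apply: le_sintegral_integral => // x; rewrite -mrestrict !patchE.
case: ifPn => //; rewrite inE => Bx; rewrite /= lee_fin.
by apply: (le_trans (kh' _ (BD _ Bx))); exact: hg.
Qed.

Lemma integral_le_cst D g (c : R) : measurable D -> (0 <= c)%R ->
  (forall x, D x -> (0 <= g x <= c)%R) ->
  \int[mu]_(x in D) (g x)%:E <= c%:E * mu D.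
Proof.
move=> mD c0 gc.
rewrite -[leRHS]adde0 -(integral_set0 mu (fun x => (g x)%:E)).
apply: integral_le_cst_add => //.
- by rewrite setI0.
- by rewrite setU0 setDv measure0.
- by move=> x /gc/andP[].
- by move=> x /gc/andP[].
Qed.

Lemma measure_le_cover (I : finType) A (C : I -> set T) (M : \bar R) : measurable A ->
  (forall i, measurable (C i)) -> (forall i, mu (C i) = M) ->
  (forall x, A x -> exists i, C i x) -> mu A <= #|I|%:R%:E * M.
Proof.
move=> mA mC CM AC.
apply: (@le_trans _ _ (\sum_i mu (C i))).
  apply: (@le_trans _ _ (mu (\big[setU/set0]_i C i))).
    apply: le_measure; rewrite ?inE//; first exact: bigsetU_measurable.
    by move=> x /AC[i Cix]; rewrite (bigD1 i)//=; left.
  suff [] : measurable (\big[setU/set0]_i C i) /\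
      mu (\big[setU/set0]_i C i) <= \sum_i mu (C i) by [].
  apply: (big_ind2 (fun S m => measurable S /\ mu S <= m)) => //.
    by rewrite measure0.
  move=> S1 m1 S2 m2 [mS1 Sm1] [mS2 Sm2]; split; first exact: measurableU.
  exact: (le_trans (measureU2 mu mS1 mS2) (leeD Sm1 Sm2)).
under eq_bigr do rewrite CM.
by rewrite sumr_const mule_natl.
Qed.

End lower_integral.

(** * Planar convex sets *)

Section convexity.
Context {R : realType}.
Implicit Types (A : set (R * R)) (u : R * R -> R) (x y p v : R * R) (t r : R).
Local Notation leb := (@lebesgue_measure R).
Local Notation mu := (leb \x leb)%E.

(** The combination [x <| t |> y] puts the weight [t] on [x], hence the exchanged points in the
    proof. *)
Lemma convex_setP A : convex_set A <->
  (forall x y t, A x -> A y -> 0 <= t <= 1 -> A ((1 - t) *: x + t *: y)).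
Proof.
split=> [cA x y t Ax Ay /andP[t0 t1]|cA x y t].
  rewrite addrC -in_setE.
  exact: (cA y x (Itv01 t0 t1) (mem_set Ay) (mem_set Ax)).
rewrite !inE => Ax Ay.
by have := cA y x t%:num Ay Ax; rewrite addrC; apply; rewrite ge0 le1.
Qed.

Lemma concave_functionP A u : concave_function A u <->
  (forall x y t, A x -> A y -> 0 <= t <= 1 ->
    (1 - t) * u x + t * u y <= u ((1 - t) *: x + t *: y)).
Proof.
split=> [cu x y t Ax Ay /andP[t0 t1]|cu t x y].
  rewrite addrC [in leRHS]addrC.
  exact: (cu (Itv01 t0 t1) y x (mem_set Ay) (mem_set Ax)).
rewrite !inE => Ax Ay.
have t01 : 0 <= t%:num <= 1 by rewrite ge0 le1.
by have := cu y x t%:num Ay Ax t01; rewrite addrC [in leRHS]addrC.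
Qed.

Lemma interiorE A p : A° p <-> exists2 r, 0 < r & forall v, `|v| < r -> A (p + v).
Proof.
split=> [/nbhs_ballP[r /= r0 rA]|[r r0 rA]].
  exists r => // v vr; apply: rA; rewrite -ball_normE/=.
  by rewrite opprD addNKr normrN.
apply/nbhs_ballP; exists r => //= y; rewrite -ball_normE/= => py.
by rewrite -(subrK p y) addrC; apply: rA; rewrite distrC.
Qed.

Lemma closureE A p : closure A p <-> forall r, 0 < r -> exists2 y, A y & `|p - y| < r.
Proof.
split=> [cAp r r0|cAp B /nbhs_ballP[r /= r0 rB]].
  have [y [Ay]] := cAp _ (nbhsx_ballx p r r0).
  by rewrite -ball_normE/=; exists y.
by have [y Ay yr] := cAp r r0; exists y; split => //; apply: rB; rewrite -ball_normE.
Qed.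

(** A nearby point [z] of [A] replaces [y]; the error [t (y - z)] and the displacement [v] are both
    absorbed by the ball around [p]. *)
Lemma convex_closure_interior A p y t : convex_set A -> A° p -> closure A y ->
  0 <= t < 1 -> A° ((1 - t) *: p + t *: y).
Proof.
move=> /convex_setP cA /interiorE[r r0 rA] /closureE cAy /andP[t0 t1].
have s0 : 0 < 1 - t by lra.
have h0 : 0 < (1 - t) * r / 2 by rewrite divr_gt0// mulr_gt0.
have [z Az yz] := cAy _ h0.
apply/interiorE; exists ((1 - t) * r / 2) => // v vr.
rewrite (_ : _ + v = (1 - t) *: (p + (1 - t)^-1 *: (t *: (y - z) + v)) + t *: z).
  apply: cA => //; last by rewrite t0 ltW.
  apply: rA; rewrite normrZ normfV gtr0_norm// ltr_pdivrMl//.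
  apply: (le_lt_trans (ler_normD _ _)); rewrite normrZ ger0_norm//.
  have : t * `|y - z| <= `|y - z| by rewrite ler_piMl// ltW.
  lra.
rewrite scalerDr scalerA divff ?gt_eqF// scale1r scalerBr.
by rewrite -[RHS]addrA [_ + v + _]addrAC subrK addrA.
Qed.

(* A homothety of ratio t < 1 centred at an interior point maps [closure A] into
   the interior, whence [t^2 mu (closure A) <= mu A°]. *)
Lemma convex_boundary_null A (M : R) : convex_set A -> A° !=set0 ->
  (forall x, closure A x -> `|x| < M) -> mu (closure A `\` A°) = 0.
Proof.
move=> cA [p Ap] AM.
have mC : measurable (closure A : set (measurableTypeR R * measurableTypeR R)).
  by apply: plane_closed_measurable; exact: closed_closure.
have mI : measurable (A° : set (measurableTypeR R * measurableTypeR R)).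
  by apply: plane_open_measurable; exact: open_interior.
have AC : A° `<=` closure A.
  by move=> x /interior_subset; exact: subset_closure.
have Coo : (mu (closure A) < +oo)%E by exact: plane_bounded_measure mC AM.
have scaled t : 0 < t < 1 -> ((t * t)%:E * mu (closure A) <= mu A°)%E.
  move=> /andP[t0 t1].
  pose S := [set x | closure A (((1 - t^-1) *: p) + t^-1 *: x)].
  have tV0 : 0 < t^-1 by rewrite invr_gt0.
  have mS : measurable (S : set (measurableTypeR R * measurableTypeR R)).
    apply: plane_closed_measurable.
    apply: (@closed_comp _ _ (fun x => (1 - t^-1) *: p + t^-1 *: x)) => [x _|].
      by apply: cvgD; [exact: cvg_cst|exact: cvgZr].
    exact: closed_closure.
  rewrite -(plane_measure_affine ((1 - t^-1) *: p) tV0 mC) muleA -EFinM.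
  rewrite mulrACA divff ?gt_eqF// mulr1 mul1e.
  apply: le_measure; rewrite ?inE// => x /= Sx.
  have := convex_closure_interior cA Ap Sx (_ : 0 <= t < 1).
  rewrite ltW//= t1 => /(_ isT).
  rewrite scalerDr !scalerA divff ?gt_eqF// scale1r addrA -scalerDl.
  by rewrite mulrBr mulr1 divff ?gt_eqF// subrKA subrr scale0r add0r.
have Ioo : (mu A° < +oo)%E.
  by apply: le_lt_trans Coo; apply: le_measure; rewrite ?inE.
have le_mu : (mu (closure A) <= mu A°)%E.
  have Cfin : mu (closure A) \is a fin_num by rewrite ge0_fin_numE.
  have Ifin : mu A° \is a fin_num by rewrite ge0_fin_numE.
  have i0 : 0 <= fine (mu A°) by rewrite fine_ge0.
  move: scaled; rewrite -(fineK Cfin) -(fineK Ifin); move: i0.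
  move: (fine _) (fine _) => c i i0 scaled.
  rewrite lee_fin leNgt; apply/negP => ic.
  have c_gt0 : 0 < c := le_lt_trans i0 ic.
  (* For this [t] one has [i / c = 2 t - 1], so [t^2 <= i / c] would force [(1 - t)^2 <= 0]. *)
  pose t := (1 + i / c) / 2.
  have ic0 : 0 <= i / c by rewrite divr_ge0// ltW.
  have ic1 : i / c < 1 by rewrite ltr_pdivrMr// mul1r.
  have /scaled : 0 < t < 1 by rewrite /t; lra.
  rewrite -EFinM lee_fin => tci.
  have : (1 - t) ^+ 2 > 0 by rewrite exprn_gt0// subr_gt0 /t; lra.
  have : t * t <= i / c by rewrite ler_pdivlMr.
  rewrite expr2 /t; lra.
apply/eqP; rewrite eq_le measure_ge0 andbT measureD//=.
rewrite setIidr// leeBlDr ?add0e//.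
by rewrite ge0_fin_numE.
Qed.

End convexity.

(** * Gradients and the growth condition *)

Section gradients.
Context {R : realType}.
Implicit Types (A : set (R * R)) (u : R * R -> R) (x y p v : R * R) (t r s : R).

(** Concavity on the segment from [x] to [x + s v] bounds the increment from below; the upper bound
    holds because [x] lies between [x - s v] and [x + h v]. *)
Lemma concave_increment_bound A u x v s e h : concave_function A u ->
  0 < s -> A x -> A (x + h *: v) -> A (x - s *: v) -> A (x + s *: v) ->
  u x - e <= u (x - s *: v) -> u x - e <= u (x + s *: v) ->
  0 < h < s -> `|u (x + h *: v) - u x| <= h * (e / s).
Proof.
move=> /concave_functionP cu s0 Ax Ah Am Ap um up /andP[h0 hs].
have [s0' h0'] := (ltW s0, ltW h0).
have t01 : 0 <= h / s <= 1.
  by rewrite divr_ge0//= ler_pdivrMr// mul1r ltW.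
have hs0 : 0 < h + s by rewrite addr_gt0.
have hs0' := ltW hs0.
have r01 : 0 <= h / (h + s) <= 1.
  by rewrite divr_ge0//= ler_pdivrMr// mul1r lerDl ltW.
have low := cu _ _ _ Ax Ap t01.
have upp := cu _ _ _ Ah Am r01.
rewrite (_ : _ *: _ + _ *: _ = x + h *: v) in low; last first.
  rewrite scalerDr addrA -scalerDl subrK scale1r scalerA; congr (_ + _ *: _).
  by rewrite divfK// gt_eqF.
rewrite (_ : _ *: _ + _ *: _ = x) in upp; last first.
  rewrite scalerBr scalerDr addrACA -scalerDl subrK scale1r !scalerA -scalerBl.
  rewrite (_ : _ - _ = 0) ?scale0r ?addr0//; by field; rewrite gt_eqF.
have -> : h * (e / s) = h / s * e by rewrite mulrA mulrAC.
rewrite ler_norml; apply/andP; split.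
  have : 0 <= h / s * (u (x + s *: v) - u x + e) by rewrite mulr_ge0 ?divr_ge0//; lra.
  lra.
have : 0 <= h / s * (u (x - s *: v) - u x + e) by rewrite mulr_ge0 ?divr_ge0//; lra.
have : (h + s) / s * ((1 - h / (h + s)) * u (x + h *: v) + h / (h + s) * u (x - s *: v))
  <= (h + s) / s * u x by rewrite ler_pM2l// divr_gt0.
have -> : (h + s) / s * ((1 - h / (h + s)) * u (x + h *: v) + h / (h + s) * u (x - s *: v))
 = u (x + h *: v) + h / s * u (x - s *: v).
  by field; rewrite !gt_eqF.
have -> : (h + s) / s * u x = u x + h / s * u x by field; rewrite gt_eqF.
lra.
Qed.

(** The functional involves [grad u] at every point, so the bound has to cover points where a
    partial derivative does not exist. *)
Lemma derive_bound u x v s K : 0 < s ->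
  (forall h, 0 < `|h| < s -> `|u (x + h *: v) - u x| <= `|h| * K) ->
  0 <= K -> `|'D_v u x| <= K.
Proof.
move=> s0 uK K0; have [ud|/dvgP nud] := pselect (derivable u x v); last first.
  (* the default value of a limit that does not exist is [0] *)
  by rewrite /derive nud normr0.
have B : \forall h \near 0^', `|h^-1 *: ((u \o shift x) (h *: v) - u x)| <= K.
  near=> h.
  have h0 : h != 0 by near: h; exact: nbhs_dnbhs_neq.
  rewrite normrZ normfV ler_pdivrMl ?normr_gt0//= [h *: v + x]addrC; apply: uK.
  rewrite normr_gt0 h0/=; near: h; apply: dnbhs0_lt; exact: s0.
rewrite ler_norml; apply/andP; split.
  apply: limr_ge => //; near=> h.
  have : `|h^-1 *: ((u \o shift x) (h *: v) - u x)| <= K by near: h.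
  by rewrite ler_norml => /andP[].
apply: limr_le => //; near=> h.
have : `|h^-1 *: ((u \o shift x) (h *: v) - u x)| <= K by near: h.
by rewrite ler_norml => /andP[].
Unshelve. all: by end_near. Qed.

Lemma grad_affine p (c : R) x : grad (fun y => dot2 p y + c) x = p.
Proof.
have D v : 'D_v (fun y => dot2 p y + c) x = dot2 p v.
  apply: lim_near_cst => //.
  near=> h.
  have h0 : h != 0 by near: h; exact: nbhs_dnbhs_neq.
  rewrite /dot2 /= /GRing.scale/=.
  by field.
by rewrite /grad !D /dot2 /= !mulr1 !mulr0 addr0 add0r -surjective_pairing.
Unshelve. all: by end_near. Qed.

Lemma grad_near u (w : R * R -> R) x :
  (\near x, u x = w x) -> grad u x = grad w x.
Proof. by move=> uv; rewrite /grad !(near_eq_derive _ uv). Qed.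

Lemma enorm_le x (K : R) : `|x.1| <= K -> `|x.2| <= K -> enorm x <= 2 * K.
Proof.
move=> xK yK; have K0 : 0 <= K := le_trans (normr_ge0 _) xK.
have K2 : 0 <= 2 * K by rewrite mulr_ge0.
rewrite -[leRHS](ger0_norm K2) -sqrtr_sqr.
move: xK yK; rewrite /enorm !ler_norml => /andP[? ?] /andP[? ?].
have : 0 <= (K - x.1) * (K + x.1) by rewrite mulr_ge0//; lra.
have : 0 <= (K - x.2) * (K + x.2) by rewrite mulr_ge0//; lra.
rewrite ler_sqrt ?sqr_ge0// /dot2 expr2; nra.
Qed.

Lemma enorm_scale (k : R) x : 0 <= k -> enorm (k *: x) = k * enorm x.
Proof.
move=> k0; rewrite /enorm (_ : dot2 _ _ = k ^+ 2 * dot2 x x); last first.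
  by rewrite /dot2/= /GRing.scale/=; ring.
by rewrite sqrtrM ?sqr_ge0// sqrtr_sqr ger0_norm.
Qed.

Lemma enorm_gt0 x : x != 0 -> 0 < enorm x.
Proof.
move=> x0; rewrite sqrtr_gt0 /dot2 -!expr2 lt_neqAle addr_ge0 ?sqr_ge0// andbT eq_sym.
apply: contra x0; rewrite paddr_eq0 ?sqr_ge0// !sqrf_eq0.
by case: x => a b /= /andP[/eqP-> /eqP->].
Qed.

Lemma norm_le_enorm x : `|x| <= enorm x.
Proof.
have H (a b : R) : `|a| <= Num.sqrt (a * a + b * b).
  rewrite -[`|a|]sqrtr_sqr ler_sqrt -?expr2 ?addr_ge0 ?sqr_ge0//.
  by rewrite lerDl sqr_ge0.
by rewrite prod_normE ge_max H /enorm /dot2 addrC H.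
Qed.

(** The growth condition with [N = 1] and [x = 0] gives [|y| f y < f 0] for large [|y|]; on a
    compact square continuity suffices. Boundedness of [f] makes the integrals finite, so that
    common parts can be cancelled. *)
Lemma growth_bounded (f : R * R -> R) : continuous f -> (forall x, 0 < f x) ->
  growth_condition f -> exists B : R, forall x, f x <= B.
Proof.
move=> cf f0 /(_ 1 ltr01)[d d0 fd].
pose K : set (R * R) := `[- d^-1, d^-1]%classic `*` `[- d^-1, d^-1]%classic.
have cK : compact K by apply: compact_setX; exact: segment_compact.
have /compact_bounded[M [_ MB]] : compact (f @` K).
  by apply: continuous_compact => //; exact: continuous_subspaceT.
exists (Num.max (M + 1) (d * f 0)) => y; rewrite le_max.
have [yd|yd] := ltP d^-1 (enorm y); apply/orP; [right|left].
  have dV : 0 < d^-1 by rewrite invr_gt0.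
  have y0 : 0 < enorm y := lt_trans dV yd.
  have yn0 : y != 0.
    by apply: contraTneq y0 => ->; rewrite /enorm /dot2/= mulr0 addr0 sqrtr0 ltxx.
  have := fd 0 y yn0; rewrite (_ : enorm 0 = 0); last first.
    by rewrite /enorm /dot2/= mulr0 addr0 sqrtr0.
  rewrite addr0 !mul1r invf_plt ?posrE// => /(_ yd).
  rewrite ltr_pdivlMr ?mulr_gt0// mul1r => yf.
  have : d^-1 * f y <= f 0.
    by apply: ltW; apply: le_lt_trans yf; rewrite ler_pM2r// ltW.
  by rewrite ler_pdivrMl.
have Ky : K y.
  move: (le_trans (norm_le_enorm y) yd); rewrite prod_normE ge_max => /andP[].
  by rewrite !ler_norml => ? ?; split; rewrite /= in_itv.
have MM : M < M + 1 by rewrite ltrDl.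
have h := MB _ MM (f y).
by apply: le_trans (ler_norm _) _; apply: h; exists y.
Qed.

End gradients.

(** * Behaviour of the solution near the support line *)

Section near_boundary.
Context {R : realType}.
Implicit Types (A : set (R * R)) (u d : R * R -> R) (x y z p v w : R * R) (t r s e : R).

(** [H] is the infimum over [r] of the upper bounds of [u] on the strips [d < r], and [x1] is a
    cluster point of near-maximisers. Since [u] is not assumed continuous at the boundary, [H] is
    only approached near [x1] and need not be [u x1]. *)
Lemma compact_limsup_attained A u d x0 (M : R) : compact A -> continuous d ->
  (forall x, A x -> 0 <= d x) -> (forall x, A x -> u x <= M) -> A x0 -> d x0 = 0 ->
  exists H x1, [/\ u x0 <= H, A x1, d x1 = 0,
    forall e, 0 < e -> exists2 r, 0 < r & forall x, A x -> d x < r -> u x < H + e &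
    forall e, 0 < e -> exists y, [/\ A y, `|y - x1| < e & H - e < u y]].
Proof.
move=> cA cd d0 uM Ax0 dx0.
pose S := [set h | exists2 r, 0 < r & forall x, A x -> d x < r -> u x <= h].
have Slb h : S h -> u x0 <= h by move=> [r r0]; apply => //; rewrite dx0.
have hS : has_inf S.
  split; first by exists M, 1 => // x Ax _; exact: uM.
  by exists (u x0) => h; exact: Slb.
pose H := inf S.
have low e r : 0 < e -> 0 < r -> exists x, [/\ A x, d x < r & H - e < u x].
  move=> e0 r0; apply/not_existsP => no.
  have : S (H - e).
    exists r => // x Ax dr; rewrite leNgt; apply/negP => ux.
    by apply: (no x).
  by move/(ge_inf hS.2); rewrite -/H; lra.
pose E e := [set x | [/\ A x, d x < e & H - e < u x]].
pose F := filter_from [set e | 0 < e] E.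
have FF : ProperFilter F.
  apply: filter_from_proper; last by move=> e /= e0; exact: low.
  apply: filter_from_filter; first by exists 1 => /=.
  move=> e1 e2 /= e10 e20; exists (Num.min e1 e2); first by rewrite /= lt_min e10.
  move=> x [Ax]; rewrite lt_min => /andP[? ?] ue.
  have [? ?] : Num.min e1 e2 <= e1 /\ Num.min e1 e2 <= e2.
    by rewrite !ge_min !lexx orbT.
  by split; split => //; lra.
have FA : F A by exists 1 => //= x [].
have [x1 [Ax1 clx1]] := cA F FF FA.
have meet e r : 0 < e -> 0 < r -> exists y, [/\ A y, d y < r, `|y - x1| < e & H - e < u y].
  move=> e0 r0.
  have m0 : 0 < Num.min e r by rewrite lt_min e0.
  have FE : F (E (Num.min e r)) by exists (Num.min e r).
  have [y [[Ay dy uy] /=]] := clx1 _ _ FE (nbhsx_ballx x1 e e0).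
  rewrite -ball_normE/= distrC => xy; exists y; split => //.
    by move: dy; rewrite lt_min => /andP[].
  by apply: le_lt_trans uy; rewrite lerD2l lerN2 ge_min lexx.
exists H, x1; split => //.
- exact: lb_le_inf hS.1 Slb.
- apply/eqP; rewrite eq_le d0// andbT leNgt; apply/negP => d1.
  have d2 : d x1 / 2 < d x1 by lra.
  have : \forall y \near x1, d x1 / 2 < d y by apply: (cvgr_gt _ (cd x1)); exact: d2.
  move=> /nbhs_ballP[e /= e0 ed].
  have d20 : 0 < d x1 / 2 by lra.
  have [y [_ dy yx _]] := meet _ _ e0 d20.
  have /ed/= : ball x1 e y by rewrite -ball_normE/= distrC.
  lra.
- move=> e e0; have [h [r r0 hr] hH] := inf_adherent e0 hS.
  by exists r => // x Ax dr; apply: le_lt_trans hH; exact: hr.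
- by move=> e e0; have [y []] := meet e 1 e0 ltr01; exists y.
Qed.

(** Only points [y] near [x1] are known to have values near [H]; the target is rewritten as a
    combination of such a [y] and a point of the ball around [z], where [u] is nonnegative. *)
Lemma concave_radial_lower A u x1 z (H rho : R) t :
  concave_function A u -> (forall x, A x -> 0 <= u x) ->
  (forall e, 0 < e -> exists y, [/\ A y, `|y - x1| < e & H - e < u y]) ->
  0 < rho -> (forall v, `|v| < rho -> A (z + v)) -> 0 < t <= 1 ->
  (1 - t) * H <= u ((1 - t) *: x1 + t *: z).
Proof.
move=> /concave_functionP cu u0 ax rho0 zA /andP[t0 t1].
apply/ler_addgt0Pr => e e0.
have m0 : 0 < Num.min e (t * rho) by rewrite lt_min e0 mulr_gt0.
have [y [Ay yx Hu]] := ax _ m0.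
have [ye yt] : `|y - x1| < e /\ `|y - x1| < t * rho.
  by move: yx; rewrite lt_min => /andP[].
have Hue : H - e < u y.
  by apply: le_lt_trans Hu; rewrite lerD2l lerN2 ge_min lexx.
(* Chosen so that [(1 - t) y + t (z + v) = (1 - t) x1 + t z]; the bound [t * rho] on [|y - x1|]
   keeps [z + v] in the ball. *)
pose v := (t^-1 - 1) *: (x1 - y).
have tV1 : 0 <= t^-1 - 1 by rewrite subr_ge0 invf_ge1.
have Av : A (z + v).
  apply: zA; rewrite normrZ ger0_norm// distrC mulrBl mul1r.
  have : t^-1 * `|y - x1| < rho by rewrite ltr_pdivrMl.
  by have := normr_ge0 (y - x1); lra.
have := cu _ _ t Ay Av; rewrite (ltW t0) t1 => /(_ isT).
rewrite (_ : _ *: _ + _ *: _ = (1 - t) *: x1 + t *: z); last first.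
  rewrite /v scalerDr scalerA mulrBr divff ?gt_eqF// mulr1.
  by rewrite addrCA -scalerDr [y + _]addrC subrK addrC.
have : 0 <= t * u (z + v) by rewrite mulr_ge0 ?u0// ltW.
have : 0 <= (1 - t) * (u y - H + e) by rewrite mulr_ge0; lra.
have : 0 <= t * e by rewrite mulr_ge0 ?ltW.
lra.
Qed.

End near_boundary.

(** * Geometry of the slab where [u] exceeds a steep linear function *)

Section slab.
Context {R : realType}.
Implicit Types (A : set (R * R)) (u d : R * R -> R) (x y z p v w nu : R * R) (t r s e : R).

Definition cross2 x y : R := x.1 * y.2 - x.2 * y.1.

Lemma pair_ext x y : x.1 = y.1 -> x.2 = y.2 -> x = y.
Proof. by case: x y => [a b] [c d] /= -> ->. Qed.

Lemma dot2_le nu v : `|dot2 nu v| <= (`|nu.1| + `|nu.2|) * `|v|.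
Proof.
have [v1 v2] : `|v.1| <= `|v| /\ `|v.2| <= `|v|.
  by rewrite prod_normE !le_max !lexx orbT.
rewrite (le_trans (ler_normD _ _))// !normrM mulrDl.
by rewrite lerD// ler_wpM2l.
Qed.

Lemma cross2_le w v : `|cross2 w v| <= (`|w.1| + `|w.2|) * `|v|.
Proof.
have [v1 v2] : `|v.1| <= `|v| /\ `|v.2| <= `|v|.
  by rewrite prod_normE !le_max !lexx orbT.
rewrite (le_trans (ler_normB _ _))// !normrM mulrDl.
by rewrite lerD// ler_wpM2l.
Qed.

Lemma slab_height (kap delta t al ala : R) : 0 < kap -> 0 < delta <= 1 / 32 ->
  delta / 2 <= t <= delta -> kap / 4 <= al <= kap / 2 -> 0 <= ala <= 2 * kap ->
  exists2 alj, (1 - t) * alj = al - t * ala &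
  [/\ kap / 8 <= alj, alj <= kap & kap / 16 < (1 - t) * alj].
Proof.
move=> kap0 /andP[de0 de1] /andP[t0 t1] /andP[al0 al1] /andP[ala0 ala1].
have s0 : 0 < 1 - t by lra.
have tala0 : 0 <= t * ala by rewrite mulr_ge0//; lra.
have tala1 : t * ala <= 1 / 32 * (2 * kap) by apply: ler_pM => //; lra.
have sal : (1 - t) * ((al - t * ala) / (1 - t)) = al - t * ala.
  by rewrite mulrC divfK// gt_eqF.
exists ((al - t * ala) / (1 - t)) => //; split; last by rewrite sal; lra.
  rewrite ler_pdivlMr//.
  have : kap / 8 * (1 - t) <= kap / 8 * 1 by rewrite ler_pM2l//; lra.
  lra.
rewrite ler_pdivrMr//.
have : kap * (31 / 32) <= kap * (1 - t) by rewrite ler_pM2l//; lra.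
lra.
Qed.

(** The point [a] contributes a nonnegative amount, and the two losses by a factor [1 - delta]
    combine through [(1 - delta)^2 >= 1 - 2 delta]. *)
Lemma slab_value (H delta t alj uj ua ux : R) : 0 < H -> 0 < delta <= 1 / 32 ->
  0 <= t <= delta -> alj <= delta -> (1 - alj) * H <= uj -> 0 <= ua ->
  (1 - t) * uj + t * ua <= ux -> (1 - 2 * delta) * H <= ux.
Proof.
move=> H0 /andP[de0 de1] /andP[t0 t1] ad uj0 ua0; apply: le_trans.
have : 0 <= t * ua by exact: mulr_ge0.
have : (1 - delta) * ((1 - delta) * H) <= (1 - t) * uj.
  apply: ler_pM; [lra|by rewrite mulr_ge0; lra|lra|apply: le_trans uj0].
  by rewrite ler_pM2r//; lra.
have : 0 <= delta * delta * H by rewrite !mulr_ge0//; lra.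
lra.
Qed.

(** The part [t a] accounts for the whole coordinate [t b] of [x] along [q], so the unperturbed [j]
    lies on the ray from [x1] in direction [w]. A displacement [v] of [x] is passed on to the ball
    spanning the cone, divided by [(1 - t) alj]. *)
Lemma combination_shift (x1 a x v w q : R * R) (al ala b t alj : R) :
  x - x1 = al *: w + (t * b) *: q -> a - x1 = ala *: w + b *: q ->
  (1 - t) * alj = al - t * ala -> (1 - t) * alj != 0 ->
  x + v = (1 - t) *: ((1 - alj) *: x1 + alj *: (x1 + w + ((1 - t) * alj)^-1 *: v)) + t *: a.
Proof.
move=> xE aE sal s0.
have szv : ((1 - t) * alj) *: (((1 - t) * alj)^-1 *: v) = v.
  by rewrite scalerA divff// scale1r.
rewrite -[in LHS]szv; move: (_ *: v) => z.
rewrite -(subrK x1 x) -(subrK x1 a) xE aE.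
have -> : al = (1 - t) * alj + t * ala by rewrite sal subrK.
by apply: pair_ext; rewrite /= /GRing.scale/=; ring.
Qed.

Lemma dot_cross_decomposition (nu w y : R * R) : dot2 nu w = 1 ->
  y = dot2 nu y *: w + cross2 w y *: (- nu.2, nu.1).
Proof.
move=> nuw; apply: pair_ext; rewrite /dot2 /cross2 /= /GRing.scale/=.
  transitivity (dot2 nu w * y.1); first by rewrite nuw mul1r.
  by rewrite /dot2; ring.
transitivity (dot2 nu w * y.2); first by rewrite nuw mul1r.
by rewrite /dot2; ring.
Qed.

(* [dot2 nu] and [cross2 w] are the coordinates in the basis formed by [w] and
   the vector [(- nu.2, nu.1)] of the support line; [b] is the second coordinate
   of a point of the set [k * dot2 nu (x - x1) <= u x] almost farthest from [x1]
   along that line. *)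
Lemma boundary_slab_exists A u nu x1 w (M H rho L : R) :
  convex_set A -> concave_function A u -> (forall x, A x -> 0 <= u x <= M) ->
  (forall x, A x -> `|x| <= L) -> A x1 ->
  (forall x, A x -> 0 <= dot2 nu (x - x1)) -> dot2 nu w = 1 ->
  0 < H -> 0 < rho -> (`|nu.1| + `|nu.2|) * rho <= 1 ->
  (forall v, `|v| < rho + rho -> A (x1 + w + v)) ->
  (forall e, 0 < e -> exists2 r, 0 < r &
    forall x, A x -> dot2 nu (x - x1) < r -> u x < H + e) ->
  (forall e, 0 < e -> exists y, [/\ A y, `|y - x1| < e & H - e < u y]) ->
  forall delta, 0 < delta <= 1 / 32 -> exists K, forall k, K <= k ->
  exists2 b, b != 0 &
  [/\ (forall x, A x -> k * dot2 nu (x - x1) <= u x ->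
        dot2 nu (x - x1) <= 2 * (H / k) /\ `|cross2 w (x - x1)| <= 2 * `|b|) &
      (forall x, delta / 2 <= cross2 w (x - x1) / b <= delta ->
        H / k / 4 <= dot2 nu (x - x1) <= H / k / 2 ->
        forall v, `|v| <= rho * (H / k) / 16 ->
        [/\ A (x + v), k * dot2 nu (x + v - x1) <= u (x + v),
            (1 - 2 * delta) * H <= u (x + v) & u (x + v) <= (1 + delta) * H])].
Proof.
move=> cA cu uM AL Ax1 nuA nuw H0 rho0 nurho zA usc att delta /andP[de0 de1].
have cA' := (convex_setP A).1 cA; have cu' := (concave_functionP A u).1 cu.
have u0 x : A x -> 0 <= u x by move=> /uM/andP[].
have [r r0 ur] := usc (delta * H) (mulr_gt0 de0 H0).
have M0 : 0 <= M by have /andP[] := uM _ Ax1; lra.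
have radial z t : `|z| < rho -> 0 < t <= 1 ->
    A ((1 - t) *: x1 + t *: (x1 + w + z)) /\
    (1 - t) * H <= u ((1 - t) *: x1 + t *: (x1 + w + z)).
  move=> zr /andP[t0 t1]; split.
    by apply: cA' => //; [apply: zA; lra|rewrite ltW].
  apply: (concave_radial_lower cu u0 att rho0); last by rewrite t0.
  by move=> v vr; rewrite -addrA; apply: zA; apply: le_lt_trans (ler_normD _ _) _; lra.
(* The summands serve, in order, to give [k > 0], [M / k < r], [H / k < r] and [H / k <= delta]. *)
exists (1 + M / r + H / r + H / delta) => k Kk.
have [Mr Hr Hd] : [/\ 0 <= M / r, 0 < H / r & 0 < H / delta].
  by rewrite !divr_gt0// divr_ge0// ltW.
have k0 : 0 < k by lra.
pose kap := H / k; rewrite -/kap.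
have kkap : k * kap = H by rewrite /kap mulrC divfK// gt_eqF.
have kap0 : 0 < kap by rewrite divr_gt0.
have kapd : kap <= delta.
  have : H / delta <= k by lra.
  by rewrite /kap !ler_pdivrMr// mulrC.
have kapr : kap < r.
  have : H / r < k by lra.
  by rewrite /kap !ltr_pdivrMr// mulrC.
have Mkr : M / k < r.
  have : M / r < k by lra.
  by rewrite !ltr_pdivrMr// mulrC.
pose W := [set x | A x /\ k * dot2 nu (x - x1) <= u x].
have Wd x : W x -> dot2 nu (x - x1) <= 2 * kap.
  move=> [Ax kx]; have /andP[_ uxM] := uM _ Ax.
  have dM : dot2 nu (x - x1) <= M / k by rewrite ler_pdivlMr// mulrC; lra.
  have := ur x Ax (le_lt_trans dM Mkr) => ux.
  rewrite -(ler_pM2l k0) mulrCA kkap.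
  have : delta * H <= 1 / 32 * H by rewrite ler_pM2r.
  lra.
pose B := [set `|cross2 w (x - x1)| | x in W].
pose C := (`|w.1| + `|w.2|) * (L + L).
have BC x : W x -> `|cross2 w (x - x1)| <= C.
  move=> [Ax _]; apply: le_trans (cross2_le _ _) _.
  apply: ler_wpM2l; first by rewrite addr_ge0.
  by apply: le_trans (ler_normB _ _) _; have := AL _ Ax; have := AL _ Ax1; lra.
pose q : R * R := (- nu.2, nu.1).
(* A tilt by [eps] along [q] yields a point of [W] off the ray in direction [w]; hence [sup B > 0],
   and [b] will be nonzero. *)
have [eps eps0 epsq] : exists2 eps : R, 0 < eps & `|eps *: q| < rho.
  exists (rho / (1 + `|q|)).
    by rewrite divr_gt0// ltr_pwDl.
  rewrite normrZ gtr0_norm ?divr_gt0 ?ltr_pwDl//.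
  rewrite mulrAC ltr_pdivrMr ?ltr_pwDl// ltr_pM2l//.
  by rewrite ltrDr.
have [y0 Wy0 By0] : exists2 y, W y & 0 < `|cross2 w (y - x1)|.
  have t01 : 0 < kap / 4 <= 1 by apply/andP; split; lra.
  have [Ay uy] := radial _ _ epsq t01.
  move: Ay uy; set y := _ + _ => Ay uy.
  have yx1 : y - x1 = (kap / 4) *: (w + eps *: q).
    by apply: pair_ext; rewrite /y /= /GRing.scale/=; ring.
  exists y; last first.
    rewrite yx1 (_ : cross2 _ _ = kap / 4 * eps * dot2 nu w); last first.
      by rewrite /cross2 /dot2 /= /GRing.scale/=; ring.
    by rewrite nuw mulr1 normr_gt0 mulf_neq0// gt_eqF// divr_gt0.
  split => //; rewrite yx1 (_ : dot2 _ _ = kap / 4 * dot2 nu w); last first.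
    by rewrite /dot2 /= /GRing.scale/=; ring.
  rewrite nuw mulr1 mulrA kkap.
  have : kap / 4 * H <= 1 / 4 * H by rewrite ler_pM2r//; lra.
  lra.
have hB : has_sup B.
  by split; [exists `|cross2 w (y0 - x1)|, y0|exists C => _ [x Wx <-]; exact: BC].
have sB0 : 0 < sup B.
  by apply: lt_le_trans By0 _; apply: ub_le_sup => //; [exact: hB.2|exists y0].
(* The supremum need not be attained; [a] comes within a factor 2 of it, which is the factor in the
   bound by [2 * |b|]. *)
have [_ [a Wa <-] aB] := sup_adherent (divr_gt0 sB0 (ltr0n R 2)) hB.
pose b := cross2 w (a - x1).
have b0 : b != 0 by rewrite -normr_gt0 /b; lra.
exists b => //; split.
  move=> x Ax kx; have Wx : W x by [].
  split; first exact: Wd.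
  have : `|cross2 w (x - x1)| <= sup B by apply: ub_le_sup; [exact: hB.2|exists x].
  rewrite -/b in aB; lra.
move=> x; set t := cross2 w (x - x1) / b; set al := dot2 nu (x - x1).
move=> tI alI v vr.
have tb : cross2 w (x - x1) = t * b by rewrite /t divfK.
have [Aa ka] := Wa.
pose ala := dot2 nu (a - x1).
have alaI : 0 <= ala <= 2 * kap by rewrite /ala nuA//= Wd.
have deI : 0 < delta <= 1 / 32 by rewrite de0.
have [alj sal [alj0 alj1 sal0]] := slab_height kap0 deI tI alI alaI.
have sp0 : 0 < (1 - t) * alj by apply: lt_trans sal0; rewrite divr_gt0.
have zr : `|((1 - t) * alj)^-1 *: v| < rho.
  rewrite normrZ gtr0_norm ?invr_gt0// ltr_pdivrMl//; apply: le_lt_trans vr _.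
  by rewrite -mulrA mulrC ltr_pM2r.
have alj01 : 0 < alj <= 1.
  by move: kap0 alj0 alj1 kapd de1; clear; move=> *; apply/andP; split; lra.
have [Aj uj] := radial _ _ zr alj01.
have xj := combination_shift v (_ : x - x1 = al *: w + (t * b) *: q)
  (dot_cross_decomposition (a - x1) nuw) sal (_ : (1 - t) * alj != 0).
rewrite -tb gt_eqF// in xj.
have {}xj := xj (dot_cross_decomposition _ nuw) isT.
have t01 : 0 <= t <= 1.
  by move: tI de0 de1; clear; move=> /andP[? ?] *; apply/andP; split; lra.
have Axv : A (x + v) by rewrite xj; exact: cA'.
(* [9 / 16 = 1 / 2 + 1 / 16]: the height of [x] plus that of the displacement [v]. *)
have dxv : dot2 nu (x + v - x1) <= kap * (9 / 16).
  rewrite (_ : dot2 _ _ = al + dot2 nu v); last by rewrite /al /dot2/=; ring.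
  have : dot2 nu v <= kap / 16.
    apply: le_trans (le_trans (ler_norm _) (dot2_le nu v)) _.
    apply: (@le_trans _ _ ((`|nu.1| + `|nu.2|) * (rho * kap / 16))).
      by apply: ler_wpM2l; rewrite ?addr_ge0.
    have -> : (`|nu.1| + `|nu.2|) * (rho * kap / 16) =
        (`|nu.1| + `|nu.2|) * rho * (kap / 16) by rewrite !mulrA.
    by rewrite -[leRHS]mul1r ler_pM2r// divr_gt0.
  by move: alI; clear; move=> /andP[_ ?] *; lra.
have uup : u (x + v) <= (1 + delta) * H.
  rewrite mulrDl mul1r; apply/ltW/ur => //; apply: le_lt_trans dxv _.
  by move: kapr kap0; clear; lra.
have ulo : (1 - 2 * delta) * H <= u (x + v).
  have tI' : 0 <= t <= delta by move: t01 tI => /andP[-> _] /andP[].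
  apply: (slab_value H0 deI tI' (le_trans alj1 kapd) uj (u0 _ Aa)).
  by rewrite xj; exact: cu'.
split => //; apply: le_trans ulo.
(* As [delta <= 1 / 32], the factor [1 - 2 delta] is at least [15 / 16], above [9 / 16]. *)
apply: (@le_trans _ _ (k * (kap * (9 / 16)))); first by rewrite ler_pM2l.
rewrite mulrA kkap mulrC ler_pM2r//.
by move: de1; clear; lra.
Qed.

End slab.

(** * Cutting the graph by a steep plane *)

Section competitor.
Context {R : realType}.
Implicit Types (A W : set (R * R)) (u : R * R -> R) (x y z p v w nu : R * R) (t r s e : R).
Local Notation mu := ((@lebesgue_measure R) \x (@lebesgue_measure R))%E.
Local Notation plane := (measurableTypeR R * measurableTypeR R)%type.

Lemma continuous_dot2 p y : continuous (fun x => dot2 p (x - y)).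
Proof.
move=> x; rewrite /dot2; apply: cvgD; apply: cvgM; try exact: cvg_cst.
  by apply: cvgB; [exact: cvg_fst|exact: cvg_cst].
by apply: cvgB; [exact: cvg_snd|exact: cvg_cst].
Qed.

Lemma dot2B p x y : dot2 p (x - y) = dot2 p x - dot2 p y.
Proof. by rewrite /dot2/=; ring. Qed.

Lemma dot2Z (k : R) p x : dot2 (k *: p) x = k * dot2 p x.
Proof. by rewrite /dot2 /= /GRing.scale/=; ring. Qed.

Lemma dot2_comb p t x y :
  dot2 p ((1 - t) *: x + t *: y) = (1 - t) * dot2 p x + t * dot2 p y.
Proof. by rewrite /dot2 /= /GRing.scale/=; ring. Qed.

Lemma concave_superlevel A u p (c : R) : convex_set A -> concave_function A u ->
  convex_set [set x | A x /\ dot2 p x + c <= u x].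
Proof.
move=> cA cu; apply/convex_setP => x y t [Ax px] [Ay py] /[dup] t01 /andP[t0 t1].
split; first exact: (convex_setP A).1.
apply: le_trans ((concave_functionP A u).1 cu _ _ _ Ax Ay t01).
rewrite dot2_comb.
have s0 : 0 <= 1 - t by lra.
have := ler_wpM2l s0 px; have := ler_wpM2l t0 py; lra.
Qed.

Lemma concave_min_affine A u p (c : R) : convex_set A -> concave_function A u ->
  concave_function A (fun x => Num.min (u x) (dot2 p x + c)).
Proof.
move=> cA cu; apply/concave_functionP => x y t Ax Ay /[dup] t01 /andP[t0 t1].
have s0 : 0 <= 1 - t by lra.
rewrite le_min; apply/andP; split.
  apply: le_trans ((concave_functionP A u).1 cu _ _ _ Ax Ay t01).
  by apply: lerD; apply: ler_wpM2l => //; rewrite ge_min lexx.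
have : (1 - t) * Num.min (u x) (dot2 p x + c) <= (1 - t) * (dot2 p x + c).
  by apply: ler_wpM2l => //; rewrite ge_min lexx orbT.
have : t * Num.min (u y) (dot2 p y + c) <= t * (dot2 p y + c).
  by apply: ler_wpM2l => //; rewrite ge_min lexx orbT.
rewrite dot2_comb; lra.
Qed.

(** The competitor is the minimum of [u] and the affine function: its gradient is [p] in the
    interior of [W], and it coincides with [u] near interior points of [A] off the closure of [W].
    Boundaries of convex sets being null, minimality compares only the contributions of [W], of
    which [P] is a part. *)
Lemma cut_comparison (f : R * R -> R) A (M B : R) u p (c b : R) (P : set (R * R)) :
  compact A -> convex_set A -> A° !=set0 ->
  (forall x, 0 < f x <= B) -> is_solution f A M u ->
  (forall x, A x -> 0 <= dot2 p x + c) ->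
  let W := [set x | A x /\ dot2 p x + c <= u x] in
  W° !=set0 -> measurable (P : set plane) -> P `<=` W° -> 0 <= b ->
  (forall x, P x -> b <= f (grad u x)) ->
  (b%:E * mu P <= (f p)%:E * mu W°)%E.
Proof.
move=> cptA cA A0 fB [[cu uM] umin] pA W W0 mP PW b0 bf.
have cW : convex_set W by exact: concave_superlevel.
have clA : closed A by exact: compact_closed.
have WA : W `<=` A by move=> x [].
have clWA : closure W `<=` A by move=> x /(closure_subset WA); rewrite -(closure_id _).1.
have [L AL] : exists L, forall x, A x -> `|x| < L.
  have /compact_bounded[K [_ KA]] := cptA.
  have K1 : K < K + 1 by rewrite ltrDl.
  exists (K + 2) => x Ax; have := KA _ K1 x Ax; rewrite /=; lra.
have nullA : mu (closure A `\` A°) = 0%E.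
  by apply: convex_boundary_null => // x; rewrite -(closure_id _).1//; exact: AL.
have nullW : mu (closure W `\` W°) = 0%E.
  by apply: convex_boundary_null => // x /clWA; exact: AL.
pose Bo := A° `\` closure W.
have oW : open (W°) by exact: open_interior.
have oB : open Bo.
  by apply: openI; [exact: open_interior|apply: closed_openC; exact: closed_closure].
have mA : measurable (A : set plane) by exact: plane_closed_measurable.
have mW : measurable (W° : set plane) by exact: plane_open_measurable.
have mB : measurable (Bo : set plane) by exact: plane_open_measurable.
have BA : Bo `<=` A by move=> x [/interior_subset].
have WA' : W° `<=` A by move=> x /interior_subset/WA.
have WB0 : W° `&` Bo = set0.
  by rewrite -subset0 => x [/interior_subset Wx [_]]; apply; exact: subset_closure.
have Aoo (D : set (R * R)) : measurable (D : set plane) -> D `<=` A -> (mu D < +oo)%E.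
  by move=> mD DA; apply: (plane_bounded_measure mD) => x /DA; exact: AL.
pose v := fun x => Num.min (u x) (dot2 p x + c).
have vadm : admissible A M v.
  split; first exact: concave_min_affine.
  move=> x Ax; rewrite /v le_min ge_min; have /andP[-> ->] := uM _ Ax.
  by rewrite pA.
have gradW x : W° x -> grad v x = p.
  move=> Wx; rewrite -[RHS](grad_affine p c x); apply: grad_near.
  near=> y; rewrite /v; apply/min_idPr.
  have : W° y by near: y; exact: open_nbhs_nbhs.
  by move=> /interior_subset[].
have gradB x : Bo x -> grad v x = grad u x.
  move=> Bx; apply: grad_near; near=> y; rewrite /v; apply/min_idPl.
  have [/interior_subset Ay nWy] : Bo y by near: y; exact: open_nbhs_nbhs.
  rewrite leNgt; apply/negP => uy; apply: nWy; apply: subset_closure.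
  by split => //; exact: ltW.
have f0 x : 0 <= f x by have /andP[/ltW] := fB x.
have B0 : 0 <= B by have /andP[? ?] := fB 0; exact: le_trans (f0 0) _.
have null : mu (A `\` (W° `|` Bo)) = 0%E.
  have mcW : measurable (closure W `\` W° : set plane).
    by apply: measurableD => //; apply: plane_closed_measurable; exact: closed_closure.
  have mcA : measurable (closure A `\` A° : set plane).
    apply: measurableD; first by apply: plane_closed_measurable; exact: closed_closure.
    by apply: plane_open_measurable; exact: open_interior.
  apply/eqP; rewrite eq_le measure_ge0 andbT.
  rewrite -[leRHS](_ : mu (closure W `\` W°) + mu (closure A `\` A°) = 0)%E; last first.
    by rewrite nullA nullW adde0.
  apply: le_trans (measureU2 mu mcW mcA).
  apply: le_measure; rewrite ?inE; [|exact: measurableU|].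
    by apply: measurableD => //; exact: measurableU.
  move=> x [Ax nx]; have [Aix|nAx] := pselect (A° x); last first.
    by right; split => //; exact: subset_closure.
  have [cWx|ncWx] := pselect (closure W x); last by exfalso; apply: nx; right.
  by left; split => // Wix; apply: nx; left.
have PA : P `<=` A by move=> x /PW/WA'.
have PB0 : P `&` Bo = set0.
  by rewrite -subset0 => x [/PW Wx Bx]; rewrite -WB0.
have finB : (\int[mu]_(x in Bo) (f (grad u x))%:E)%E \is a fin_num.
  rewrite ge0_fin_numE; last by apply: integral_ge0 => x _; rewrite lee_fin.
  apply: le_lt_trans (integral_le_cst mu mB B0 _) _.
    by move=> x _; rewrite f0/=; have /andP[] := fB (grad u x).
  by apply: lte_mul_pinfty; rewrite ?lee_fin// Aoo.
(* The integral over [Bo] is common to [u] and the competitor, and being finite it may be added to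
   both sides. *)
rewrite -(leeD2rE _ _ finB).
apply: le_trans (integral_ge_cst_add mP mB (Aoo _ mP PA) PA BA PB0 b0 (fun x _ => f0 _) bf) _.
apply: le_trans (umin _ vadm) _.
apply: integral_le_cst_add => // x.
  by move=> /gradW ->.
by move=> /gradB ->.
Unshelve. all: by end_near. Qed.

End competitor.

(** * Measure of cells and gradient bounds *)

Section cells.
Context {R : realType}.
Implicit Types (A W : set (R * R)) (u : R * R -> R) (x y z p v w nu : R * R) (t r s e : R).
Local Notation mu := ((@lebesgue_measure R) \x (@lebesgue_measure R))%E.
Local Notation plane := (measurableTypeR R * measurableTypeR R)%type.

(** For independent [p1] and [p2], a parallelogram. Cells with equal side lengths in these
    coordinates are translates of each other, so areas are compared without a determinant. *)
Definition cell p1 p2 x1 (a0 a1 b0 b1 : R) : set (R * R) :=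
  [set x | a0 <= dot2 p1 (x - x1) <= a1 /\ b0 <= dot2 p2 (x - x1) <= b1].

Lemma cell_measurable p1 p2 x1 (a0 a1 b0 b1 : R) :
  measurable (cell p1 p2 x1 a0 a1 b0 b1 : set plane).
Proof.
have H p (a b : R) : measurable ([set x | a <= dot2 p (x - x1) <= b] : set plane).
  apply: plane_closed_measurable.
  apply: (@closed_comp _ _ (fun x => dot2 p (x - x1)) [set y | a <= y <= b]) => [x _|].
    exact: continuous_dot2.
  by rewrite -set_itvcc; exact: interval_closed.
by apply: measurableI; exact: H.
Qed.

Lemma unit_index (n : nat) (y : R) : 0 <= y <= n.+1%:R ->
  exists i : 'I_n.+1, i%:R <= y <= i%:R + 1.
Proof.
elim: n => [|n IH] /andP[y0 yn]; first by exists ord0; rewrite y0 add0r.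
have [yn'|yn'] := leP y n.+1%:R.
  have [|i iy] := IH; first by rewrite y0.
  by exists (widen_ord (leqnSn _) i).
by exists ord_max; rewrite /= (ltW yn') natr1.
Qed.

(** [e1], [e2] is the basis dual to [p1], [p2]; translating the given cell along it produces a grid
    of copies covering the large cell, hence [A]. *)
Lemma cell_cover_measure A p1 p2 (e1 e2 : R * R) x1 (n m : nat) (a0 b0 a b l1 l2 : R) :
  dot2 p1 e1 = 1 -> dot2 p1 e2 = 0 -> dot2 p2 e1 = 0 -> dot2 p2 e2 = 1 ->
  0 < l1 -> 0 < l2 -> measurable (A : set plane) ->
  A `<=` cell p1 p2 x1 a0 (a0 + n.+1%:R * l1) b0 (b0 + m.+1%:R * l2) ->
  (mu A <= (n.+1 * m.+1)%:R%:E * mu (cell p1 p2 x1 a (a + l1) b (b + l2)))%E.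
Proof.
move=> p11 p12 p21 p22 l10 l20 mA Asub.
pose shift (i : 'I_n.+1 * 'I_m.+1) : R * R :=
  (a - a0 - i.1%:R * l1) *: e1 + (b - b0 - i.2%:R * l2) *: e2.
have <- : #|{: 'I_n.+1 * 'I_m.+1}| = (n.+1 * m.+1)%N by rewrite card_prod !card_ord.
pose C i : set plane := cell p1 p2 (x1 - shift i) a (a + l1) b (b + l2).
apply: (measure_le_cover (mu := mu) (C := C) mA).
- by move=> i; exact: cell_measurable.
- move=> i; rewrite -[RHS](plane_measure_translate (shift i)); last exact: cell_measurable.
  congr (mu _); apply/funext => x; rewrite /C /cell /=.
  by rewrite (_ : x - (x1 - shift i) = shift i + x - x1)// opprB addrCA addrA.
move=> x /Asub[/andP[x0 x1'] /andP[x2 x3]].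
have idx (y c l : R) k : 0 < l -> c <= y -> y <= c + k.+1%:R * l ->
    exists i : 'I_k.+1, 0 <= y - c - i%:R * l <= l.
  move=> l0 cy yc; have l0' := ltW l0.
  have [|i /andP[i0 i1]] := @unit_index k ((y - c) / l).
    by rewrite divr_ge0 ?subr_ge0//= ler_pdivrMr// lerBlDl.
  exists i; move: i0 i1; rewrite ler_pdivlMr// ler_pdivrMr// mulrDl mul1r => *.
  by apply/andP; split; lra.
have [i /andP[i0 i1]] := idx _ _ _ _ l10 x0 x1'.
have [j /andP[j0 j1]] := idx _ _ _ _ l20 x2 x3.
exists (i, j).
have E p : dot2 p (x - (x1 - shift (i, j))) = dot2 p (x - x1) +
    ((a - a0 - i%:R * l1) * dot2 p e1 + (b - b0 - j%:R * l2) * dot2 p e2).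
  by rewrite /shift /dot2 /= /GRing.scale/=; ring.
rewrite /C /cell /mkset !E p11 p12 p21 p22 !mulr0 !mulr1 addr0 add0r.
by split; apply/andP; split; lra.
Qed.

(** The values at distance [s] on both sides of [x] drop by at most [hi - lo], which bounds each
    partial derivative by [(hi - lo) / s]; the factor 2 pays for passing from coordinates to the
    Euclidean norm. *)
Lemma grad_enorm_le A u x s (lo hi : R) : concave_function A u -> 0 < s ->
  (forall v, `|v| <= s -> [/\ A (x + v), lo <= u (x + v) & u (x + v) <= hi]) ->
  enorm (grad u x) <= 2 * ((hi - lo) / s).
Proof.
move=> cu s0 xu.
have [Ax lox xhi] : [/\ A x, lo <= u x & u x <= hi].
  by have := xu 0; rewrite normr0 addr0; apply; exact: ltW.
have inc v h : `|v| = 1 -> 0 < h < s ->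
    `|u (x + h *: v) - u x| <= h * ((hi - lo) / s).
  move=> v1 hI; have /andP[h0 hs] := hI.
  have [] := xu (h *: v); first by rewrite normrZ v1 mulr1 gtr0_norm// ltW.
  have [] := xu (s *: v); first by rewrite normrZ v1 mulr1 gtr0_norm.
  have [] := xu (- (s *: v)); first by rewrite normrN normrZ v1 mulr1 gtr0_norm.
  move=> Am lom _ Ap lop _ Ah _ _.
  by apply: (concave_increment_bound cu s0 Ax Ah Am Ap) => //; lra.
have K0 : 0 <= (hi - lo) / s by apply: divr_ge0; [rewrite subr_ge0 (le_trans lox)|exact: ltW].
have D v : `|v| = 1 -> `|'D_v u x| <= (hi - lo) / s.
  move=> v1; apply: (derive_bound s0) => // h /andP[h0 hs].
  have [hp|hn|h00] := ltgtP 0 h; last by move: h0; rewrite -h00 normr0 ltxx.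
    by rewrite (gtr0_norm hp); apply: inc => //; rewrite hp -(gtr0_norm hp).
  rewrite (ltr0_norm hn); have -> : h *: v = (- h) *: (- v) by rewrite scalerN scaleNr opprK.
  apply: inc; first by rewrite normrN.
  by rewrite oppr_gt0 hn -(ltr0_norm hn).
apply: enorm_le; apply: D; rewrite prod_normE /= normr1 normr0.
  by rewrite max_l.
by rewrite max_r.
Qed.

End cells.

(** * Vanishing on the boundary *)

Section boundary_value.
Context {R : realType}.
Implicit Types (A W : set (R * R)) (u : R * R -> R) (x y z p v w nu : R * R) (t r s e : R).
Local Notation mu := ((@lebesgue_measure R) \x (@lebesgue_measure R))%E.
Local Notation plane := (measurableTypeR R * measurableTypeR R)%type.

Lemma dot2_gt0 p : p != 0 -> 0 < dot2 p p.
Proof. by move=> p0; rewrite -sqrtr_gt0; exact: enorm_gt0. Qed.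

Lemma dot2_rot p (b : R) : dot2 p (b *: (- p.2, p.1)) = 0.
Proof. by rewrite /dot2 /= /GRing.scale/=; ring. Qed.

Lemma cross2_rot w p (b : R) : cross2 w (b *: (- p.2, p.1)) = b * dot2 p w.
Proof. by rewrite /cross2 /dot2 /= /GRing.scale/=; ring. Qed.

Lemma cross2_self w : cross2 w w = 0.
Proof. by rewrite /cross2; ring. Qed.

Lemma cross2_dual w x (b : R) : dot2 (b^-1 *: (- w.2, w.1)) x = cross2 w x / b.
Proof. by rewrite dot2Z mulrC /dot2 /cross2/=; congr (_ / _); ring. Qed.

(** The growth condition solved for [f x]: when [1 + |x|] is smaller than [|y|] by a factor
    [C * delta], the value [f x] exceeds [f y] by the inverse factor times [N]. *)
Lemma growth_gain (f : R * R -> R) (N C dg delta : R) x y :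
  (forall x y, y != 0 -> (1 + enorm x) / enorm y < dg ->
    N < (1 + enorm x) * f x / (enorm y * f y)) ->
  (forall x, 0 < f x) -> y != 0 -> 0 < C -> 0 < delta -> C * delta < dg ->
  1 + enorm x <= C * delta * enorm y -> N / (C * delta) * f y <= f x.
Proof.
move=> fN f0 y0 C0 de0 Cd xy.
have ey0 := enorm_gt0 y0; have Cde0 : 0 < C * delta by rewrite mulr_gt0.
have /(fN _ _ y0) : (1 + enorm x) / enorm y < dg.
  by apply: le_lt_trans Cd; rewrite ler_pdivrMr.
rewrite ltr_pdivlMr ?mulr_gt0// => /ltW Nf.
have {Nf} : N * f y * enorm y <= C * delta * f x * enorm y.
  rewrite -mulrA [f y * _]mulrC (le_trans Nf)// [leRHS]mulrAC.
  by rewrite ler_pM2r.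
by rewrite ler_pM2r// => Nf; rewrite mulrAC ler_pdivrMr// [f x * _]mulrC.
Qed.

(** An oscillation of [3 delta H] over the radius [rho H / (16 k)] gives [96 delta k / rho], with
    [96 = 2 * 3 * 16]; the summand [1] is at most [delta k / rho], which makes [97]. *)
Lemma slab_ball_grad (u : R * R -> R) A x nu (H delta rho k : R) :
  concave_function A u -> 0 < H -> 0 < delta -> 0 < rho -> 0 < k -> nu != 0 ->
  rho <= delta * k ->
  (forall v, `|v| <= rho * (H / k) / 16 ->
     [/\ A (x + v), (1 - 2 * delta) * H <= u (x + v) & u (x + v) <= (1 + delta) * H]) ->
  1 + enorm (grad u x) <= 97 / (rho * enorm nu) * delta * enorm (k *: nu).
Proof.
move=> cu H0 de0 rho0 k0 nu0 kbig xu.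
have s0 : 0 < rho * (H / k) / 16 by rewrite divr_gt0// mulr_gt0// divr_gt0.
have := grad_enorm_le cu s0 xu.
have -> : 2 * (((1 + delta) * H - (1 - 2 * delta) * H) / (rho * (H / k) / 16)) =
    96 * (delta * k / rho) by field; rewrite !gt_eqF.
rewrite enorm_scale ?(ltW k0)//.
have -> : 97 / (rho * enorm nu) * delta * (k * enorm nu) = 97 * (delta * k / rho).
  by field; rewrite !gt_eqF// enorm_gt0.
have : 1 <= delta * k / rho by rewrite ler_pdivlMr// mul1r.
by clear; lra.
Qed.

(** The contradiction is numerical: [64 * m.+1] translates of [P] cover the interior of [W], while
    on [P] the integrand for [u] is at least [65 * m.+1] times that of the competitor. *)
Lemma boundary_value_zero (Omega : set (R * R)) (M : R) (f : R * R -> R) u x0 (n : R * R) :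
  compact Omega -> convex_set Omega -> Omega° !=set0 -> (forall x, 0 < f x) ->
  continuous f -> growth_condition f -> is_solution f Omega M u ->
  Omega x0 -> n != 0 -> (forall x, Omega x -> dot2 n x <= dot2 n x0) -> u x0 = 0.
Proof.
move=> cptO cO iO f0 cf fg sol Ox0 n0 nO.
have [[cu uM] umin] := sol.
have [ux0 _] := andP (uM _ Ox0).
apply/eqP; rewrite eq_le ux0 andbT leNgt; apply/negP => {ux0} ux0.
pose d x := dot2 (- n) (x - x0).
have dE x : d x = dot2 n x0 - dot2 n x by rewrite /d /dot2/=; ring.
have d0 x : Omega x -> 0 <= d x by move=> /nO; rewrite dE subr_ge0.
have uM' x : Omega x -> u x <= M by move=> /uM/andP[].
have dx0 : d x0 = 0 by rewrite dE subrr.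
have [H [x1 [uH Ox1 dx1 usc att]]] :=
  compact_limsup_attained cptO (@continuous_dot2 R (- n) x0) d0 uM' Ox0 dx0.
have H0 : 0 < H := lt_le_trans ux0 uH.
have [z0 /interiorE[rho1 rho10 zO]] := iO.
have r0 : 0 < d z0.
  (* A short step from [z0] along the outward normal [n] stays in [Omega], where [d >= 0]; as it
     lowers [d], the value [d z0] is positive. *)
  pose s := rho1 / (1 + `|n|).
  have n1 : 0 < 1 + `|n| by rewrite ltr_pwDl.
  have s0 : 0 < s by rewrite divr_gt0.
  have /zO/d0 : `|s *: n| < rho1.
    by rewrite normrZ gtr0_norm// mulrAC ltr_pdivrMr// ltr_pM2l// ltrDr.
  have -> : d (z0 + s *: n) = d z0 - s * dot2 n n.
    by rewrite /d /dot2 /= /GRing.scale/=; ring.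
  by have := mulr_gt0 s0 (dot2_gt0 n0); lra.
(* Normalised so that [dot2 nu w = 1]. Since [x1 + w = z0], the cone with apex [x1] is spanned by a
   ball about [z0]. *)
pose nu := (d z0)^-1 *: (- n); pose w := z0 - x1.
have nuE x : dot2 nu (x - x1) = d x / d z0.
  rewrite -[d x]subr0 -dx1 /nu dot2Z mulrC; congr (_ / _).
  by rewrite /d /dot2/=; ring.
have nuw : dot2 nu w = 1 by rewrite nuE divff// gt_eqF.
have nu0 : nu != 0.
  apply/eqP => nu0; move: nuw; rewrite nu0 /dot2/= !mul0r addr0 => /eqP.
  by rewrite eq_sym oner_eq0.
pose T := `|nu.1| + `|nu.2|.
have T0 : 0 <= T by rewrite addr_ge0.
(* The first bound keeps the ball of radius [rho + rho] about [z0] in [Omega]; the second gives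
   [T * rho <= 1]. *)
pose rho := Num.min (rho1 / 2) (1 / (1 + T)).
have T1 : 0 < 1 + T by rewrite ltr_pwDl.
have rho0 : 0 < rho by rewrite lt_min !divr_gt0.
have nurho : T * rho <= 1.
  have : T * rho <= T * (1 / (1 + T)) by rewrite ler_wpM2l// ge_min lexx orbT.
  move/le_trans; apply; rewrite mulrA mulr1 ler_pdivrMr// mul1r; lra.
have zO' v : `|v| < rho + rho -> Omega (x1 + w + v).
  move=> vr; rewrite /w addrCA subrr addr0; apply: zO; apply: lt_le_trans vr _.
  have : rho <= rho1 / 2 by rewrite ge_min lexx.
  by clear; lra.
have [L OL] : exists L, forall x, Omega x -> `|x| <= L.
  have /compact_bounded[K [_ KA]] := cptO.
  by exists (K + 1) => x Ox; apply: (KA (K + 1)) => //; rewrite ltrDl.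
have nuO x : Omega x -> 0 <= dot2 nu (x - x1).
  by move=> Ox; rewrite nuE; apply: divr_ge0; [exact: d0|exact: ltW].
have usc' e : 0 < e -> exists2 r, 0 < r &
    forall x, Omega x -> dot2 nu (x - x1) < r -> u x < H + e.
  move=> /usc[r r0' ur]; exists (r / d z0); first by rewrite divr_gt0.
  by move=> x Ox; rewrite nuE ltr_pM2r ?invr_gt0//; exact: ur.
have E0 := enorm_gt0 nu0.
pose C := 97 / (rho * enorm nu).
have C0 : 0 < C by rewrite divr_gt0// mulr_gt0.
(* With [N = 65 * C] the gain [N / (C * delta)] is [65 / delta], just above the [64 / delta] cells
   of the covering below. *)
have C650 : 0 < 65 * C by rewrite mulr_gt0.
have [dg dg0 fdg] := fg _ C650.
(* [delta] is made the reciprocal of an integer so that intervals of length [delta / 2] tile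
   [[-2, 2]] exactly; [32] gives [delta <= 1 / 32], and the Archimedean bound gives
   [C * delta < dg]. *)
pose m := (32 + Num.bound (C / dg))%N.
pose delta : R := m.+1%:R^-1.
have de0 : 0 < delta by rewrite invr_gt0.
have m0 : 0 < m.+1%:R :> R by [].
have de1 : delta <= 1 / 32.
  by rewrite /delta div1r lef_pV2 ?posrE// ler_nat /m -addnS leq_addr.
have Cde : C * delta < dg.
  rewrite ltr_pdivrMr// mulrC -ltr_pdivrMr//.
  apply: lt_le_trans (archi_boundP _) _; first by apply: divr_ge0; exact: ltW.
  by rewrite ler_nat /m -addSn leq_addl.
have deI : 0 < delta <= 1 / 32 by rewrite de0.
have [K slab] := boundary_slab_exists cO cu uM OL Ox1 nuO nuw H0 rho0 nurho zO' usc' att deI.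
pose k := `|K| + rho / delta + 1.
have rd0 : 0 < rho / delta by rewrite divr_gt0.
have kK : K <= k by have := ler_norm K; rewrite /k; move: rd0; clear; lra.
have k0 : 0 < k by have := normr_ge0 K; rewrite /k; move: rd0; clear; lra.
have krho : rho <= delta * k.
  rewrite mulrC -ler_pdivrMr//.
  by have := normr_ge0 K; rewrite /k; clear; lra.
have [b b0 [slabW slabP]] := slab k kK.
pose kap := H / k; have kap0 : 0 < kap by rewrite divr_gt0.
have affE x : dot2 (k *: nu) x - k * dot2 nu x1 = k * dot2 nu (x - x1).
  by rewrite dot2Z dot2B mulrBr.
pose W := [set x | Omega x /\ dot2 (k *: nu) x - k * dot2 nu x1 <= u x].
pose p2 : R * R := b^-1 *: (- w.2, w.1).
have p2E x : dot2 p2 x = cross2 w x / b by exact: cross2_dual.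
(* The upper ends are written as sums to fit the shape of the cells in [cell_cover_measure]. *)
pose P := cell nu p2 x1 (kap / 4) (kap / 4 + kap / 4) (delta / 2) (delta / 2 + delta / 2).
have half (a : R) : a / 2 + a / 2 = a by field.
have quarter (a : R) : a / 4 + a / 4 = a / 2 by field.
have Pball x : P x -> forall v, `|v| <= rho * kap / 16 ->
    [/\ Omega (x + v), k * dot2 nu (x + v - x1) <= u (x + v),
        (1 - 2 * delta) * H <= u (x + v) & u (x + v) <= (1 + delta) * H].
  by rewrite /P /cell /mkset half quarter p2E => -[Px1 Px2]; exact: slabP.
have PW : P `<=` W°.
  move=> x /Pball xv; apply/interiorE; exists (rho * kap / 16).
    by rewrite divr_gt0// mulr_gt0.
  by move=> v /ltW/xv[Oxv kxv _ _]; split => //; rewrite affE.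
pose e2 : R * R := b *: (- nu.2, nu.1).
have d12 : dot2 nu e2 = 0 by exact: dot2_rot.
have d21 : dot2 p2 w = 0 by rewrite p2E cross2_self mul0r.
have d22 : dot2 p2 e2 = 1 by rewrite p2E cross2_rot nuw mulr1 divff.
have P0 : P !=set0.
  exists (x1 + ((kap / 4) *: w + (delta / 2) *: e2)); rewrite /P /cell /mkset.
  have E p : dot2 p (x1 + ((kap / 4) *: w + (delta / 2) *: e2) - x1) =
      kap / 4 * dot2 p w + delta / 2 * dot2 p e2.
    by rewrite /dot2 /= /GRing.scale/=; ring.
  rewrite !E nuw d12 d21 d22 !mulr0 !mulr1 addr0 add0r !lexx !lerDl.
  by split; rewrite divr_ge0// ltW.
have W0 : W° !=set0 by have [x /PW] := P0; exists x.
have mP : measurable (P : set plane) by exact: cell_measurable.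
have mW : measurable (W° : set plane).
  by apply: plane_open_measurable; exact: open_interior.
have WP : (mu W° <= (8 * (8 * m + 7).+1)%:R%:E * mu P)%E.
  (* Eight rows of height [kap / 4] cover [[0, 2 kap]], and [8 * m.+1] columns of width [delta / 2]
     cover [[-2, 2]]. Both counts are passed as predecessors, hence [7] and [8 * m + 7]. *)
  apply: (@cell_cover_measure R (W°) nu p2 w e2 x1 7 (8 * m + 7) 0 (-2) (kap / 4)
    (delta / 2) (kap / 4) (delta / 2) nuw d12 d21 d22) => //.
  - by rewrite divr_gt0.
  - by rewrite divr_gt0.
  move=> x /interior_subset[Ox]; rewrite affE => /(slabW _ Ox)[xk xb].
  rewrite /cell /mkset nuO//= p2E; split.
    by move: xk; rewrite -/kap; clear; lra.
  have : `|cross2 w (x - x1) / b| <= 2.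
    by rewrite normrM normfV ler_pdivrMr// normr_gt0.
  rewrite ler_norml => /andP[-> /le_trans]; apply.
  rewrite (_ : (8 * m + 7).+1%:R = 8 * m.+1%:R :> R); last first.
    by rewrite -natrM; congr (_%:R); rewrite mulnS addnC -addSn addnC.
  have : m.+1%:R * delta = 1 by rewrite /delta divff// gt_eqF.
  by move: (m.+1%:R) => M' Md; lra.
have eN x : P x -> 65 * m.+1%:R * f (k *: nu) <= f (grad u x).
  move=> /Pball xv.
  have knu0 : k *: nu != 0 by rewrite scaler_eq0 negb_or gt_eqF.
  have -> : 65 * m.+1%:R = 65 * C / (C * delta).
    by rewrite /delta; field; rewrite !gt_eqF.
  apply: (growth_gain fdg) => //.
  apply: (slab_ball_grad cu H0) => // v /xv[? _ ? ?]; by split.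
have [B fB] := growth_bounded cf f0 fg.
have fB' x : 0 < f x <= B by rewrite f0 fB.
have cut : ((65 * m.+1%:R * f (k *: nu))%:E * mu P <= (f (k *: nu))%:E * mu W°)%E.
  apply: (cut_comparison cptO cO iO fB' sol _ W0) => //.
    by move=> x Ox; rewrite affE mulr_ge0 ?nuO// ltW.
  by rewrite !mulr_ge0// ltW.
have Poo : (mu P < +oo)%E.
  apply: (plane_bounded_measure mP (M := L + 1)) => x /PW/interior_subset[/OL xL _].
  by rewrite ltr_pwDr.
have muW : (0 < mu W°)%E.
  by apply: plane_open_measure_gt0 => //; exact: open_interior.
have Pfin : mu P \is a fin_num by rewrite ge0_fin_numE.
have Wfin : mu W° \is a fin_num.
  rewrite ge0_fin_numE//; apply: le_lt_trans WP _.
  by apply: lte_mul_pinfty; rewrite ?lee_fin.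
move: cut WP muW; rewrite -(fineK Pfin) -(fineK Wfin); move: (fine _) (fine _) => b1 b2.
rewrite !lee_fin lte_fin (_ : (8 * (8 * m + 7).+1)%:R = 64 * m.+1%:R :> R); last first.
  by rewrite -natrM; congr (_%:R); rewrite -addnS -[7.+1]/(8 * 1)%N -mulnDr mulnA addn1.
move: (m.+1%:R) (f _) (f0 (k *: nu)) => m1 y y0 cut WP W_gt0.
have := ler_wpM2l (ltW y0) WP; have := mulr_gt0 y0 W_gt0.
by move: cut; clear; lra.
Qed.

End boundary_value.

Theorem theorem1 (R : realType) (Omega : set (R * R)) (M : R)
    (f : R * R -> R) (u : R * R -> R) (x0 : R * R) (l : set (R * R))
    (Omega_compact : compact Omega)
    (Omega_convex : convex_set Omega)
    (Omega_interior : Omega° !=set0)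
    (M_gt0 : 0 < M)
    (f_gt0 : forall x, 0 < f x)
    (f_continuous : continuous f)
    (f_growth : growth_condition f)
    (u_solution : is_solution f Omega M u)
    (x0_regular : regular_point Omega x0)
    (l_support : support_line Omega x0 l)
    (endpoints_regular : forall a b : R * R,
       l `&` boundary Omega = segment a b ->
       regular_point Omega a /\ regular_point Omega b) :
  u x0 = 0.
Proof.
(* The normal of [l] is a linear functional whose maximum on [Omega] is attained at [x0]. *)
have [n [c [n0 lE nO]]] := l_support.2.
have Ox0 : Omega x0.
  have [[+ _] _] := x0_regular.
  by rewrite -(closure_id _).1//; exact: compact_closed.
have nx0 : dot2 n x0 = c by have := l_support.1; rewrite lE.
by apply: (boundary_value_zero Omega_compact Omega_convex Omega_interior f_gt0
  f_continuous f_growth u_solution Ox0 n0) => x /nO; rewrite nx0.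
Qed.
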